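(* Let $A\;_{Q_1}\otimes_{R_1}B$, $B\;_{Q_2}\otimes_{R_2}C$, $A\;_{Q_3}\otimes_{R_3}C$ be three L-R-twisted tensor products of algebras such that the following conditions are satisfied for all $a\in A$, $b\in B$, $c\in C$: \begin{align*} &(a_{R_1})_{R_3}\otimes (b_{R_1})_{R_2}\otimes (c_{R_3})_{R_2}=(a_{R_3})_{R_1}\otimes (b_{R_2})_{R_1}\otimes (c_{R_2})_{R_3},\\ &(a_{Q_1})_{Q_3}\otimes (b_{Q_1})_{Q_2}\otimes (c_{Q_3})_{Q_2}=(a_{Q_3})_{Q_1}\otimes (b_{Q_2})_{Q_1}\otimes (c_{Q_2})_{Q_3},\\ &a_{R_1}\otimes (b_{R_1})_{Q_2}\otimes c_{Q_2}=a_{R_1}\otimes (b_{Q_2})_{R_1}\otimes c_{Q_2},\\ &a_{Q_1}\otimes (b_{R_2})_{Q_1}\otimes c_{R_2}=a_{Q_1}\otimes (b_{Q_1})_{R_2}\otimes c_{R_2},\\ &(a_{Q_1})_{R_3}\otimes b_{Q_1}\otimes c_{R_3}=(a_{R_3})_{Q_1}\otimes b_{Q_1}\otimes c_{R_3},\\ &(a_{R_1})_{Q_3}\otimes b_{R_1}\otimes c_{Q_3}=(a_{Q_3})_{R_1}\otimes b_{R_1}\otimes c_{Q_3},\\ &a_{R_3}\otimes b_{Q_2}\otimes (c_{Q_2})_{R_3}=a_{R_3}\otimes b_{Q_2}\otimes (c_{R_3})_{Q_2},\\ &a_{Q_3}\otimes b_{R_2}\otimes (c_{Q_3})_{R_2}=a_{Q_3}\otimes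 b_{R_2}\otimes (c_{R_2})_{Q_3}. \end{align*} Define the maps \begin{align*} &T_1:C\otimes (A\otimes B)\rightarrow (A\otimes B)\otimes C,&& T_1(c\otimes (a\otimes b))=(a_{R_3}\otimes b_{R_2})\otimes (c_{R_3})_{R_2},\\ &V_1:(A\otimes B)\otimes C\rightarrow (A\otimes B)\otimes C,&& V_1((a\otimes b)\otimes c)=(a_{Q_3}\otimes b_{Q_2})\otimes (c_{Q_3})_{Q_2},\\ &T_2:(B\otimes C)\otimes A\rightarrow A\otimes (B\otimes C),&& T_2((b\otimes c)\otimes a)=(a_{R_3})_{R_1}\otimes (b_{R_1}\otimes c_{R_3}),\\ &V_2:A\otimes (B\otimes C)\rightarrow A\otimes (B\otimes C),&& V_2(a\otimes (b\otimes c))=(a_{Q_3})_{Q_1}\otimes (b_{Q_1}\otimes c_{Q_3}). \end{align*} Then $(A\;_{Q_1}\otimes_{R_1}B)\;_{V_1}\otimes_{T_1}C$ and $A\;_{V_2}\otimes_{T_2}(B\;_{Q_2}\otimes_{R_2}C)$ are L-R-twisted tensor products of algebras, and moreover they coincide as algebras (on the underlying space $A\otimes B\otimes C$).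
   Context: All algebras, linear maps and tensor products are over a field $k$; algebras are associative and unital. Notation: for algebras $A$, $B$ and linear maps $R:B\otimes A\to A\otimes B$, $Q:A\otimes B\to A\otimes B$ write $R(b\otimes a)=a_R\otimes b_R$, $Q(a\otimes b)=a_Q\otimes b_Q$ (implicit summation); $r$, $q$ denote further independent copies of $R$, $Q$; nested subscripts mean successive application, the subscript closest to the letter being applied first ($a_{R_Q}=(a_R)_Q$). L-R-twisted tensor product: saying that $A\;_Q\otimes_R B$ is an L-R-twisted tensor product of algebras means that $A$, $B$ are algebras and $R:B\otimes A\to A\otimes B$, $Q:A\otimes B\to A\otimes B$ are linear maps such that, for all $a,a'\in A$, $b,b'\in B$: (1) $a_R\otimes 1_R=a\otimes 1$, $1_R\otimes b_R=1\otimes b$; (2) $(aa')_R\otimes b_R=a_Ra'_r\otimes b_{R_r}$; (3) $a_R\otimes (bb')_R=a_{R_r}\otimes b_rb'_R$; (4) $a_Q\otimes 1_Q=a\otimes 1$, $1_Q\otimes b_Q=1\otimes b$; (5) $(aa')_Q\otimes b_Q=a_qa'_Q\otimes b_{Q_q}$; (6) $a_Q\otimes (bb')_Q=a_{Q_q}\otimes b_Qb'_q$; (7) $b_R\otimes a_{R_Q}\otimes b'_Q=b_R\otimes a_{Q_R}\otimes b'_Q$; (8) $a_R\otimes b_{R_Q}\otimes a'_Q=a_R\otimes b_{Q_R}\otimes a'_Q$. Then $A\;_Q\otimes_R B$ denotes $A\otimes B$ with the associative multiplication $(a\otimes b)(a'\otimes b')=a_Qa'_R\otimes b_Rb'_Q$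 (where $a_Q\otimes b'_Q=Q(a\otimes b')$, $a'_R\otimes b_R=R(b\otimes a')$) and unit $1\otimes 1$. In the claim the maps are $R_1:B\otimes A\to A\otimes B$, $Q_1:A\otimes B\to A\otimes B$, $R_2:C\otimes B\to B\otimes C$, $Q_2:B\otimes C\to B\otimes C$, $R_3:C\otimes A\to A\otimes C$, $Q_3:A\otimes C\to A\otimes C$, with the same notational conventions, e.g. $R_2(c\otimes b)=b_{R_2}\otimes c_{R_2}$, $Q_3(a\otimes c)=a_{Q_3}\otimes c_{Q_3}$. For example, the left-hand side of the first condition is obtained by forming $R_1(b\otimes a)=a_{R_1}\otimes b_{R_1}$, then $R_3(c\otimes a_{R_1})=(a_{R_1})_{R_3}\otimes c_{R_3}$, then $R_2(c_{R_3}\otimes b_{R_1})=(b_{R_1})_{R_2}\otimes (c_{R_3})_{R_2}$. *)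

(* Defs.v *)
From HB Require Import structures.
From mathcomp Require Import all_boot all_algebra generic_quotient ring_quotient.
From mathcomp Require Import boolp.
From mathcomp.multinomials Require Import monalg.
From mathcomp.finmap Require Import finmap.

Set Implicit Arguments.
Unset Strict Implicit.
Unset Printing Implicit Defensive.

Import GRing.Theory.
Local Open Scope ring_scope.
Local Open Scope quotient_scope.

Reserved Notation "u ⊗ v" (at level 43, left associativity).
Reserved Notation "\sw_ ( x , y <- t ) E"
  (at level 42, x name, y name, t at level 60, E at level 44,
   format "'[' \sw_ ( x ,  y  <-  t ) '/  '  E ']'").
Reserved Notation "x · y" (at level 40, left associativity).

Notation islinear f := (GRing.linear_for *:%R f).
Notation isbilinear f := (bilinear_for *:%R *:%R f).

(* Associative unital algebras over k.  The library's algType is not used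
   because it requires 1 <> 0, which would exclude the zero algebra; its
   hierarchy has no algebra structure over pzRingType. *)
HB.mixin Record Lmodule_isUnitalAlgebra (k : fieldType) A
    of GRing.Lmodule k A := {
  amul : A -> A -> A;
  aone : A;
  amul_bilinear : isbilinear amul;
  amulA : associative amul;
  amul1l : left_id aone amul;
  amul1r : right_id aone amul
}.

#[short(type="ualgType")]
HB.structure Definition UnitalAlgebra (k : fieldType) :=
  {A of GRing.Lmodule k A & Lmodule_isUnitalAlgebra k A}.

Notation "x · y" := (amul x y) : ring_scope.

Notation "\1" := aone : ring_scope.

Definition unital_algebra_iso (k : fieldType) (A B : ualgType k) (f : A -> B) : Prop :=
  [/\ islinear f, bijective f, f \1 = \1 & forall x y, f (x · y) = f x · f y].

Definition Lin (k : fieldType) (U W : lmodType k) (f : U -> W) (Hf : islinear f) :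
    {linear U -> W} := HB.pack f (GRing.isLinear.Build k U W *:%R f Hf).

Section TensorProduct.
Context {k : fieldType} (U V : lmodType k).

(* The subspace of the free vector space on U x V spanned by the bilinearity
   relations. *)
Inductive tensor_relation : {malg k[(U * V)%type]} -> Prop :=
| TensorRelL c u u' v :
    tensor_relation (<< (c *: u + u', v) >> - c *: << (u, v) >> - << (u', v) >>)
| TensorRelR c u v v' :
    tensor_relation (<< (u, c *: v + v') >> - c *: << (u, v) >> - << (u, v') >>)
| TensorRelComb c x y :
    tensor_relation x -> tensor_relation y -> tensor_relation (c *: x + y).

Definition tensor_relations : {pred {malg k[(U * V)%type]}} :=
  fun x => `[< tensor_relation x >].

Lemma tensor_relation0 : tensor_relation 0.
Proof.
have H := TensorRelL 0 0 0 0.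
by have := TensorRelComb (-1) H H; rewrite scaleN1r addNr.
Qed.

Lemma tensor_relations_zmod_closed : zmod_closed tensor_relations.
Proof.
split=> [|x y /asboolP Hx /asboolP Hy]; apply/asboolP; first exact: tensor_relation0.
by rewrite addrC -scaleN1r; apply: TensorRelComb.
Qed.

HB.instance Definition _ :=
  GRing.isZmodClosed.Build _ tensor_relations tensor_relations_zmod_closed.

Definition tensor : Type := {ideal_quot tensor_relations}.

HB.instance Definition _ := GRing.Zmodule.on tensor.
HB.instance Definition _ := EqQuotient.on tensor.

Local Notation pi := (\pi_tensor : {malg k[(U * V)%type]} -> tensor).

Lemma tensor_eqP x y : reflect (pi x = pi y) (`[< tensor_relation (x - y) >]).
Proof. by apply: (iffP idP) => [H|/eqmodP//]; apply/eqmodP. Qed.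

Lemma tensor_piD x y : pi (x + y) = pi x + pi y.
Proof. exact: (raddfD (\pi_({ideal_quot tensor_relations}))). Qed.

Definition tensor_scale (c : k) (t : tensor) : tensor := pi (c *: repr t).

Lemma tensor_piZ c x : pi (c *: x) = tensor_scale c (pi x).
Proof.
apply/tensor_eqP; apply/asboolP; rewrite -scalerBr -[_ *: _]addr0.
apply: TensorRelComb tensor_relation0; apply/asboolP; apply/tensor_eqP.
by rewrite reprK.
Qed.

Lemma tensor_scalerA a b t :
  tensor_scale a (tensor_scale b t) = tensor_scale (a * b) t.
Proof. by rewrite -[t]reprK -!tensor_piZ scalerA reprK. Qed.

Lemma tensor_scale1r : left_id 1 tensor_scale.
Proof. by move=> t; rewrite /tensor_scale scale1r reprK. Qed.

Lemma tensor_scalerDr : right_distributive tensor_scale +%R.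
Proof.
move=> c s t; rewrite -[s]reprK -[t]reprK -tensor_piD -!tensor_piZ.
by rewrite -tensor_piD scalerDr.
Qed.

Lemma tensor_scalerDl t : {morph tensor_scale^~ t : a b / a + b}.
Proof. by move=> a b; rewrite -[t]reprK -!tensor_piZ -tensor_piD scalerDl. Qed.

HB.instance Definition _ := GRing.Zmodule_isLmodule.Build k tensor
  tensor_scalerA tensor_scale1r tensor_scalerDr tensor_scalerDl.

Lemma tensor_pi_linear c x y : pi (c *: x + y) = c *: pi x + pi y.
Proof. by rewrite tensor_piD tensor_piZ. Qed.

Lemma tensor_pi_relation x y z c :
  tensor_relation (x - c *: y - z) -> pi x = c *: pi y + pi z.
Proof.
move=> H; rewrite -tensor_pi_linear; apply/tensor_eqP; apply/asboolP.
by rewrite opprD addrA.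
Qed.

Section FreeLift.
Context (W : lmodType k) (f : U -> V -> W).

Definition free_lift (x : {malg k[(U * V)%type]}) : W :=
  \sum_(p <- msupp x) x@_p *: f p.1 p.2.

Lemma free_liftEw (d : {fset (U * V)%type}) x : (msupp x `<=` d)%fset ->
  free_lift x = \sum_(p <- d) x@_p *: f p.1 p.2.
Proof.
move=> le_xd; rewrite /free_lift (big_fset_incl _ le_xd) // => p _ /mcoeff_outdom ->.
by rewrite scale0r.
Qed.

Lemma free_lift_linear : islinear free_lift.
Proof.
move=> c x y; pose d := (msupp x `|` msupp y `|` msupp (c *: x + y))%fset.
rewrite !(@free_liftEw d); try by apply/fsubsetP => p; rewrite !inE => ->; rewrite ?orbT.
rewrite scaler_sumr -big_split /=; apply: eq_bigr => p _.
by rewrite mcoeffD mcoeffZ scalerDl scalerA.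
Qed.

Lemma free_liftU p : free_lift << p >> = f p.1 p.2.
Proof.
by rewrite (@free_liftEw [fset p]%fset) ?msuppU_le // big_seq_fset1 mcoeffU eqxx scale1r.
Qed.

HB.instance Definition _ :=
  GRing.isLinear.Build k _ _ *:%R free_lift free_lift_linear.

Lemma free_lift_relation x : isbilinear f -> tensor_relation x -> free_lift x = 0.
Proof.
move=> [fl fr]; elim=> {x} [c u u' v|c u v v'|c x y _ Hx _ Hy].
- rewrite !linearB linearZ /= !free_liftU /= (fl v c u u').
  by rewrite -addrA -opprD subrr.
- rewrite !linearB linearZ /= !free_liftU /= (fr u c v v').
  by rewrite -addrA -opprD subrr.
- by rewrite linearP /= Hx Hy scaler0 addr0.
Qed.

Lemma free_lift_pi x : isbilinear f -> free_lift (repr (pi x)) = free_lift x.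
Proof.
move=> Hf; apply/eqP; rewrite -subr_eq0 -linearB; apply/eqP.
by apply: free_lift_relation => //; apply/asboolP; apply/tensor_eqP; rewrite reprK.
Qed.

End FreeLift.
End TensorProduct.

Arguments tensor {k} (U V)%_type_scope.

HB.lock Definition tens {k : fieldType} {U V : lmodType k} (u : U) (v : V) : tensor U V :=
  \pi_(tensor U V) << (u, v) >>.

(* Sweedler sum: f evaluated on a representative \sum_i c_i (u_i, v_i) of t.
   For bilinear f, it is the linear map on the tensor product induced by f
   (lemmas sw_tens, sw_linear). *)
HB.lock Definition sw {k : fieldType} {U V W : lmodType k} (f : U -> V -> W)
    (t : tensor U V) : W :=
  free_lift f (repr t).

Notation "U ⊗ V" := (tensor U V) : type_scope.
Notation "u ⊗ v" := (tens u v) : ring_scope.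
Notation "\sw_ ( x , y <- t ) E" := (sw (fun x y => E) t) : ring_scope.

Section TensorUniversal.
Context {k : fieldType} {U V : lmodType k}.
Implicit Types (W X : lmodType k) (t : U ⊗ V).

Lemma tensE u v : u ⊗ v = \pi_(tensor U V) << (u, v) >>.
Proof. by rewrite tens.unlock. Qed.

Lemma swE W (f : U -> V -> W) t : sw f t = free_lift f (repr t).
Proof. by rewrite sw.unlock. Qed.

Lemma tens_bilinear : isbilinear (@tens k U V).
Proof.
split=> [v c u u'|u c v v']; rewrite !tensE.
  exact: tensor_pi_relation (TensorRelL _ _ _ _).
exact: tensor_pi_relation (TensorRelR _ _ _ _).
Qed.

Lemma sw_tens W (f : U -> V -> W) u v : isbilinear f -> sw f (u ⊗ v) = f u v.
Proof. by move=> Hf; rewrite swE tensE free_lift_pi // free_liftU. Qed.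

Lemma sw_linear W (f : U -> V -> W) : isbilinear f -> islinear (sw f).
Proof.
move=> Hf c s t; rewrite !swE -free_lift_linear -[RHS](free_lift_pi _ Hf).
by rewrite tensor_pi_linear (reprK s) (reprK t).
Qed.

End TensorUniversal.

Section SweedlerTheory.
Context {k : fieldType} {U V : lmodType k}.
Implicit Types (W X : lmodType k) (t : U ⊗ V).

Lemma sw_comp W X (g : {linear W -> X}) (f : U -> V -> W) t :
  g (sw f t) = sw (fun u v => g (f u v)) t.
Proof. by rewrite !swE /free_lift linear_sum; apply: eq_bigr => p _; rewrite linearZ. Qed.

Lemma eq_sw W (f g : U -> V -> W) t : (forall u v, f u v = g u v) -> sw f t = sw g t.
Proof. by move=> e; rewrite !swE; apply: eq_bigr => p _; rewrite e. Qed.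

Lemma sw_body_linear W X (f : X -> U -> V -> W) t :
  (forall u v, islinear (fun x => f x u v)) -> islinear (fun x => sw (f x) t).
Proof.
move=> Hf c x y; rewrite !swE /free_lift scaler_sumr -big_split /=; apply: eq_bigr => p _.
by rewrite Hf scalerDr !scalerA mulrC.
Qed.

Lemma sw_exchange (U' V' : lmodType k) W (f : U -> V -> U' -> V' -> W)
    t (s : tensor U' V') :
  sw (fun u v => sw (f u v) s) t = sw (fun u' v' => sw (fun u v => f u v u' v') t) s.
Proof.
rewrite !swE /free_lift; under eq_bigr do rewrite swE /free_lift scaler_sumr.
rewrite exchange_big /=; apply: eq_bigr => p _; rewrite swE /free_lift scaler_sumr.
by apply: eq_bigr => q _; rewrite !scalerA mulrC.
Qed.

Lemma sw_tensE t : sw (@tens k U V) t = t.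
Proof.
suff H x : free_lift (@tens k U V) x = \pi_(tensor U V) x by rewrite swE H reprK.
rewrite [in RHS](monalgE x) /free_lift; elim/big_rec2: _ => [|p y z _ ->].
  exact/esym/(raddf0 (\pi_({ideal_quot (@tensor_relations k U V)}))).
have -> : << x@_p *g p >> = x@_p *: << p >> :> {malg k[(U * V)%type]}.
  by apply/malgP => q; rewrite mcoeffZ !mcoeffU; case: eqP; rewrite ?mulr1 ?mulr0.
by rewrite tensor_pi_linear tensE -surjective_pairing.
Qed.

Lemma tensor_ext W (f g : U ⊗ V -> W) :
  islinear f -> islinear g -> (forall u v, f (u ⊗ v) = g (u ⊗ v)) -> f =1 g.
Proof.
move=> Hf Hg e t.
have := eq_sw t e; rewrite -(sw_comp (Lin Hf)) -(sw_comp (Lin Hg)) /=.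
by rewrite sw_tensE.
Qed.

End SweedlerTheory.

Section LinearClosure.
Context {k : fieldType}.
Implicit Types (U V W X : lmodType k) (A : ualgType k).

Lemma lin_id X : islinear (fun x : X => x). Proof. by []. Qed.

Lemma lin_map W X U (g : {linear W -> U}) (f : X -> W) :
  islinear f -> islinear (fun x => g (f x)).
Proof. by move=> Hf c x y; rewrite Hf linearP. Qed.

Lemma lin_tensl U V X (f : X -> U) (v : V) :
  islinear f -> islinear (fun x => f x ⊗ v).
Proof. by move=> Hf c x y; rewrite Hf; apply: tens_bilinear.1. Qed.

Lemma lin_tensr U V X (u : U) (f : X -> V) :
  islinear f -> islinear (fun x => u ⊗ f x).
Proof. by move=> Hf c x y; rewrite Hf; apply: tens_bilinear.2. Qed.

Lemma lin_amull A X (f : X -> A) (v : A) :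
  islinear f -> islinear (fun x => f x · v).
Proof. by move=> Hf c x y; rewrite Hf; apply: (@amul_bilinear k A).1. Qed.

Lemma lin_amulr A X (u : A) (f : X -> A) :
  islinear f -> islinear (fun x => u · f x).
Proof. by move=> Hf c x y; rewrite Hf; apply: (@amul_bilinear k A).2. Qed.

Lemma lin_sw U V W X (f : U -> V -> W) (h : X -> U ⊗ V) :
  isbilinear f -> islinear h -> islinear (fun x => sw f (h x)).
Proof. by move=> Hf Hh c x y; rewrite Hh sw_linear. Qed.

Lemma sw_compL U V W X (g : W -> X) (f : U -> V -> W) t :
  islinear g -> g (sw f t) = sw (fun u v => g (f u v)) t.
Proof.
move=> Hg; exact: (sw_comp (Lin Hg)).
Qed.

Lemma sw_sw U V U' V' W (f : U' -> V' -> W) (g : U -> V -> U' ⊗ V') t :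
  isbilinear f -> sw f (sw g t) = \sw_(u, v <- t) sw f (g u v).
Proof. by move=> Hf; apply: sw_compL; apply: sw_linear. Qed.

End LinearClosure.

Ltac lin_step :=
  cbv beta;
  lazymatch goal with
  | |- GRing.linear_for _ (fun x => x) => exact: lin_id
  | |- GRing.linear_for _ (fun x => sw (@?F x) (@?h x)) =>
      lazymatch h with
      | fun _ => ?t => apply: sw_body_linear; intros ? ?
      | _ => apply: lin_sw; [split; intros ?|]
      end
  | |- GRing.linear_for _ (fun x => tens (@?f x) (@?g x)) =>
      lazymatch g with
      | fun _ => ?t => apply: lin_tensl
      | _ => apply: lin_tensr
      end
  | |- GRing.linear_for _ (fun x => amul (@?f x) (@?g x)) =>
      lazymatch g with
      | fun _ => ?t => apply: lin_amull
      | _ => apply: lin_amulr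
      end
  | |- GRing.linear_for _ (fun x => GRing.Linear.sort _ _) => apply: lin_map
  | |- GRing.linear_for _ (tens _) => exact: tens_bilinear.2
  | |- GRing.linear_for _ (amul _) => exact: amul_bilinear.2
  | |- GRing.linear_for _ (GRing.Linear.sort _) => exact: linearP
  | |- GRing.linear_for _ (sw _) => apply: sw_linear; split; intros ?
  end.
Ltac lin :=
  lazymatch goal with |- bilinear_for _ _ _ => split; intros ? | _ => idtac end;
  repeat lin_step.

Section TensorAssociativity.
Context {k : fieldType} (U V W : lmodType k).

Definition tensor_assoc (t : (U ⊗ V) ⊗ W) : U ⊗ (V ⊗ W) :=
  \sw_(x, w <- t) \sw_(u, v <- x) u ⊗ (v ⊗ w).

Definition tensor_assoc_inv (t : U ⊗ (V ⊗ W)) : (U ⊗ V) ⊗ W :=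
  \sw_(u, y <- t) \sw_(v, w <- y) (u ⊗ v) ⊗ w.

Lemma tensor_assoc_linear : islinear tensor_assoc.
Proof. by rewrite /tensor_assoc; lin. Qed.

HB.instance Definition _ :=
  GRing.isLinear.Build k _ _ *:%R tensor_assoc tensor_assoc_linear.

Lemma tensor_assoc_inv_linear : islinear tensor_assoc_inv.
Proof. by rewrite /tensor_assoc_inv; lin. Qed.

Lemma tensor_assocE u v w : tensor_assoc ((u ⊗ v) ⊗ w) = u ⊗ (v ⊗ w).
Proof. by rewrite /tensor_assoc !sw_tens //; lin. Qed.

Lemma tensor_assoc_invE u v w : tensor_assoc_inv (u ⊗ (v ⊗ w)) = (u ⊗ v) ⊗ w.
Proof. by rewrite /tensor_assoc_inv !sw_tens //; lin. Qed.

Lemma tensor_assocK : cancel tensor_assoc tensor_assoc_inv.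
Proof.
pose asc := Lin tensor_assoc_linear; pose inv := Lin tensor_assoc_inv_linear.
apply: (tensor_ext (f := fun t => inv (asc t)) (g := fun t => t)); [by lin|by lin|].
move=> x w; move: x.
apply: (tensor_ext (f := fun x => inv (asc (x ⊗ w))) (g := fun x => x ⊗ w));
  [by lin|by lin|].
by move=> u v; rewrite /= tensor_assocE tensor_assoc_invE.
Qed.

Lemma tensor_assoc_invK : cancel tensor_assoc_inv tensor_assoc.
Proof.
pose asc := Lin tensor_assoc_linear; pose inv := Lin tensor_assoc_inv_linear.
apply: (tensor_ext (f := fun t => asc (inv t)) (g := fun t => t)); [by lin|by lin|].
move=> u y; move: y.
apply: (tensor_ext (f := fun y => asc (inv (u ⊗ y))) (g := fun y => u ⊗ y));
  [by lin|by lin|].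
by move=> v w; rewrite /= tensor_assoc_invE tensor_assocE.
Qed.

Lemma tensor_assoc_bij : bijective tensor_assoc.
Proof. exact: Bijective tensor_assocK tensor_assoc_invK. Qed.

End TensorAssociativity.

Lemma trilinear_lift (k : fieldType) (U V W X : lmodType k) (F : U -> V -> W -> X) :
  (forall x y, islinear (fun z => F z x y)) ->
  (forall x y, islinear (fun z => F x z y)) ->
  (forall x y, islinear (fun z => F x y z)) ->
  exists2 G : U ⊗ (V ⊗ W) -> X, islinear G &
    forall x y z, G (x ⊗ (y ⊗ z)) = F x y z.
Proof.
move=> F1 F2 F3; have F23 x : isbilinear (F x) by split.
exists (fun t => \sw_(x, s <- t) \sw_(y, z <- s) F x y z).
  apply: lin_sw; last exact: lin_id.
  by split=> [s|x]; [apply: sw_body_linear|apply: sw_linear].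
move=> x y z; rewrite !sw_tens //.
by split=> [s|t]; [apply: sw_body_linear|apply: sw_linear].
Qed.

Arguments tensor_assoc {k U V W} t.

Section LRTwistedTensorProduct.
Context {k : fieldType} {A B : ualgType k}.

Record LR_twisted (R : {linear tensor B A -> tensor A B})
    (Q : {linear tensor A B -> tensor A B}) : Prop := LRTwisted {
  LR_R1l : forall a, R (\1 ⊗ a) = a ⊗ \1;
  LR_R1r : forall b, R (b ⊗ \1) = \1 ⊗ b;
  LR_RMl : forall a a' b,
    R (b ⊗ (a · a')) =
    \sw_(a1, b1 <- R (b ⊗ a)) \sw_(a2, b2 <- R (b1 ⊗ a')) (a1 · a2) ⊗ b2;
  LR_RMr : forall a b b',
    R ((b · b') ⊗ a) =
    \sw_(a1, b1 <- R (b' ⊗ a)) \sw_(a2, b2 <- R (b ⊗ a1)) a2 ⊗ (b2 · b1);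
  LR_Q1r : forall a, Q (a ⊗ \1) = a ⊗ \1;
  LR_Q1l : forall b, Q (\1 ⊗ b) = \1 ⊗ b;
  LR_QMl : forall a a' b,
    Q ((a · a') ⊗ b) =
    \sw_(a1, b1 <- Q (a' ⊗ b)) \sw_(a2, b2 <- Q (a ⊗ b1)) (a2 · a1) ⊗ b2;
  LR_QMr : forall a b b',
    Q (a ⊗ (b · b')) =
    \sw_(a1, b1 <- Q (a ⊗ b)) \sw_(a2, b2 <- Q (a1 ⊗ b')) a2 ⊗ (b1 · b2);
  LR_RQl : forall a b b',
    \sw_(a1, b1 <- R (b ⊗ a)) \sw_(a2, b2 <- Q (a1 ⊗ b')) b1 ⊗ (a2 ⊗ b2) =
    \sw_(a1, b1 <- Q (a ⊗ b')) \sw_(a2, b2 <- R (b ⊗ a1)) b2 ⊗ (a2 ⊗ b1);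
  LR_RQr : forall a a' b,
    \sw_(a1, b1 <- R (b ⊗ a)) \sw_(a2, b2 <- Q (a' ⊗ b1)) a1 ⊗ (b2 ⊗ a2) =
    \sw_(a1, b1 <- Q (a' ⊗ b)) \sw_(a2, b2 <- R (b1 ⊗ a)) a2 ⊗ (b2 ⊗ a1)
}.

Definition LR_mul (R : {linear tensor B A -> tensor A B})
    (Q : {linear tensor A B -> tensor A B}) (x y : A ⊗ B) : A ⊗ B :=
  \sw_(a, b <- x) \sw_(a', b' <- y)
    \sw_(a1, b1' <- Q (a ⊗ b')) \sw_(a1', b1 <- R (b ⊗ a'))
      (a1 · a1') ⊗ (b1 · b1').

Context (R : {linear tensor B A -> tensor A B}) (Q : {linear tensor A B -> tensor A B}).
Hypothesis RQ : LR_twisted R Q.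

Lemma LR_mul_bilinear : isbilinear (LR_mul R Q).
Proof. rewrite /LR_mul; lin. Qed.

Lemma LR_mulE a b a' b' :
  LR_mul R Q (a ⊗ b) (a' ⊗ b') =
  \sw_(a1, b1' <- Q (a ⊗ b')) \sw_(a1', b1 <- R (b ⊗ a'))
    (a1 · a1') ⊗ (b1 · b1').
Proof. by rewrite /LR_mul !sw_tens //; lin. Qed.

Lemma LR_mul1l : left_id (\1 ⊗ \1) (LR_mul R Q).
Proof.
apply: tensor_ext; [exact: LR_mul_bilinear.2|lin|move=> a b].
rewrite LR_mulE (LR_Q1l RQ) (LR_R1l RQ) !sw_tens ?amul1l //; lin.
Qed.

Lemma LR_mul1r : right_id (\1 ⊗ \1) (LR_mul R Q).
Proof.
apply: tensor_ext; [exact: LR_mul_bilinear.1|lin|move=> a b].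
rewrite LR_mulE (LR_Q1r RQ) (LR_R1r RQ) !sw_tens ?amul1r //; lin.
Qed.

Lemma LR_RQl_sw (W : lmodType k) (F : B -> A -> B -> W) a b b' :
  (forall x y, islinear (fun z => F z x y)) ->
  (forall x y, islinear (fun z => F x z y)) ->
  (forall x y, islinear (fun z => F x y z)) ->
  \sw_(a1, b1 <- R (b ⊗ a)) \sw_(a2, b2 <- Q (a1 ⊗ b')) F b1 a2 b2 =
  \sw_(a1, b1 <- Q (a ⊗ b')) \sw_(a2, b2 <- R (b ⊗ a1)) F b2 a2 b1.
Proof.
move=> F1 F2 F3; have [G GL GE] := trilinear_lift F1 F2 F3.
have := congr1 G (LR_RQl RQ a b b'); rewrite (sw_compL _ _ GL) [RHS](sw_compL _ _ GL).
move=> e; apply: etrans (etrans e _); apply: eq_sw => u v;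
  by rewrite (sw_compL _ _ GL); apply: eq_sw => *; rewrite GE.
Qed.

Lemma LR_RQr_sw (W : lmodType k) (F : A -> B -> A -> W) a a' b :
  (forall x y, islinear (fun z => F z x y)) ->
  (forall x y, islinear (fun z => F x z y)) ->
  (forall x y, islinear (fun z => F x y z)) ->
  \sw_(a1, b1 <- R (b ⊗ a)) \sw_(a2, b2 <- Q (a' ⊗ b1)) F a1 b2 a2 =
  \sw_(a1, b1 <- Q (a' ⊗ b)) \sw_(a2, b2 <- R (b1 ⊗ a)) F a2 b2 a1.
Proof.
move=> F1 F2 F3; have [G GL GE] := trilinear_lift F1 F2 F3.
have := congr1 G (LR_RQr RQ a a' b); rewrite (sw_compL _ _ GL) [RHS](sw_compL _ _ GL).
move=> e; apply: etrans (etrans e _); apply: eq_sw => u v;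
  by rewrite (sw_compL _ _ GL); apply: eq_sw => *; rewrite GE.
Qed.

Lemma LR_mul_prodl a a' a'' b b' b'' :
  LR_mul R Q ((a · a') ⊗ (b · b')) (a'' ⊗ b'') =
  \sw_(a1', b1'' <- Q (a' ⊗ b'')) \sw_(a1, b2'' <- Q (a ⊗ b1''))
  \sw_(a1'', b1' <- R (b' ⊗ a'')) \sw_(a2'', b1 <- R (b ⊗ a1''))
    (a1 · a1' · a2'') ⊗ (b1 · b1' · b2'').
Proof.
rewrite LR_mulE (LR_QMl RQ) sw_sw; last by lin.
apply: eq_sw => a1' b1''; rewrite sw_sw; last by lin.
apply: eq_sw => a1 b2''; rewrite sw_tens; last by lin.
rewrite (LR_RMr RQ) sw_sw; last by lin.
apply: eq_sw => a1'' b1'; rewrite sw_sw; last by lin.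
by apply: eq_sw => a2'' b1; rewrite sw_tens //; lin.
Qed.

Lemma LR_mul_prodr a a' a'' b b' b'' :
  LR_mul R Q (a ⊗ b) ((a' · a'') ⊗ (b' · b'')) =
  \sw_(a1, b1' <- Q (a ⊗ b')) \sw_(a2, b1'' <- Q (a1 ⊗ b''))
  \sw_(a1', b1 <- R (b ⊗ a')) \sw_(a1'', b2 <- R (b1 ⊗ a''))
    (a2 · (a1' · a1'')) ⊗ (b2 · (b1' · b1'')).
Proof.
rewrite LR_mulE (LR_QMr RQ) sw_sw; last by lin.
apply: eq_sw => a1 b1'; rewrite sw_sw; last by lin.
apply: eq_sw => a2 b1''; rewrite sw_tens; last by lin.
rewrite (LR_RMl RQ) sw_sw; last by lin.
apply: eq_sw => a1' b1; rewrite sw_sw; last by lin.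
by apply: eq_sw => a1'' b2; rewrite sw_tens //; lin.
Qed.

Lemma LR_mulA_pure a b a' b' a'' b'' :
  LR_mul R Q (a ⊗ b) (LR_mul R Q (a' ⊗ b') (a'' ⊗ b'')) =
  LR_mul R Q (LR_mul R Q (a ⊗ b) (a' ⊗ b')) (a'' ⊗ b'').
Proof.
pose H a1 s'' t' b1 p' q'' : A ⊗ B :=
  \sw_(p, r'' <- Q (a1 ⊗ q'')) \sw_(u'', v <- R (b1 ⊗ s''))
    (p · p' · u'') ⊗ (v · t' · r'').
pose K s'' t' a1 := \sw_(a1', q'' <- Q (a' ⊗ b'')) \sw_(p', b1 <- R (b ⊗ a1'))
  H a1 s'' t' b1 p' q''.
transitivity (\sw_(s'', y' <- R (b' ⊗ a'')) \sw_(a1, t' <- Q (a ⊗ y')) K s'' t' a1).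
  rewrite LR_mulE (sw_compL _ _ (LR_mul_bilinear.2 _)).
  under eq_sw => a1' q''.
    rewrite (sw_compL _ _ (LR_mul_bilinear.2 _)).
    under eq_sw => s'' y'.
      rewrite LR_mul_prodr; under eq_sw do rewrite sw_exchange; over.
    over.
  rewrite sw_exchange; apply: eq_sw => s'' y'.
  rewrite sw_exchange; apply: eq_sw => a1 t'.
  apply: eq_sw => a1' q''; apply: eq_sw => p' b1.
  by apply: eq_sw => p r''; apply: eq_sw => u'' v; rewrite !amulA.
rewrite LR_RQr_sw; try by move=> *; rewrite /K /H; lin.
rewrite LR_mulE (sw_compL _ _ (LR_mul_bilinear.1 _)); apply: eq_sw => a1 y1'.
rewrite (sw_compL _ _ (LR_mul_bilinear.1 _)).
transitivity (\sw_(s'', t' <- R (y1' ⊗ a'')) \sw_(a1', b1 <- R (b ⊗ a'))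
  \sw_(p', q'' <- Q (a1' ⊗ b'')) H a1 s'' t' b1 p' q'').
  apply: eq_sw => s'' t'; rewrite /K -LR_RQl_sw //;
  by move=> *; rewrite /H; lin.
rewrite sw_exchange; apply: eq_sw => a1' b1; rewrite LR_mul_prodl.
rewrite sw_exchange; apply: eq_sw => p' q''.
by rewrite /H sw_exchange.
Qed.

Lemma LR_mulA : associative (LR_mul R Q).
Proof.
have L1 y : islinear (LR_mul R Q ^~ y) by apply: LR_mul_bilinear.1.
have L2 x : islinear (LR_mul R Q x) by apply: LR_mul_bilinear.2.
move=> x y z; move: x; apply: tensor_ext => [||a b] //.
  by move=> c u v; rewrite !L1.
move: y; apply: tensor_ext => [||a' b'] //; first by move=> c u v; rewrite L1 L2.
  by move=> c u v; rewrite L2 L1.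
by move: z; apply: tensor_ext => [||a'' b''] //;
  [move=> c u v; rewrite !L2|exact: LR_mulA_pure].
Qed.

(* A _Q⊗_R B : the space A ⊗ B with the multiplication LR_mul R Q. *)
Definition LR_tensor of LR_twisted R Q : Type := A ⊗ B.

HB.instance Definition _ := GRing.Lmodule.on (LR_tensor RQ).
HB.instance Definition _ := Lmodule_isUnitalAlgebra.Build k (LR_tensor RQ)
  LR_mul_bilinear LR_mulA LR_mul1l LR_mul1r.

End LRTwistedTensorProduct.

Section IteratedMaps.
Context {k : fieldType} {A B C : ualgType k}.
Context (R1 : {linear tensor B A -> tensor A B}) (Q1 : {linear tensor A B -> tensor A B}).
Context (R2 : {linear tensor C B -> tensor B C}) (Q2 : {linear tensor B C -> tensor B C}).
Context (R3 : {linear tensor C A -> tensor A C}) (Q3 : {linear tensor A C -> tensor A C}).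

Definition T1_map (t : C ⊗ (A ⊗ B)) : (A ⊗ B) ⊗ C :=
  \sw_(c, x <- t) \sw_(a, b <- x)
    \sw_(a1, c1 <- R3 (c ⊗ a)) \sw_(b1, c2 <- R2 (c1 ⊗ b)) (a1 ⊗ b1) ⊗ c2.

Definition V1_map (t : (A ⊗ B) ⊗ C) : (A ⊗ B) ⊗ C :=
  \sw_(x, c <- t) \sw_(a, b <- x)
    \sw_(a1, c1 <- Q3 (a ⊗ c)) \sw_(b1, c2 <- Q2 (b ⊗ c1)) (a1 ⊗ b1) ⊗ c2.

Definition T2_map (t : (B ⊗ C) ⊗ A) : A ⊗ (B ⊗ C) :=
  \sw_(y, a <- t) \sw_(b, c <- y)
    \sw_(a1, c1 <- R3 (c ⊗ a)) \sw_(a2, b1 <- R1 (b ⊗ a1)) a2 ⊗ (b1 ⊗ c1).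

Definition V2_map (t : A ⊗ (B ⊗ C)) : A ⊗ (B ⊗ C) :=
  \sw_(a, y <- t) \sw_(b, c <- y)
    \sw_(a1, c1 <- Q3 (a ⊗ c)) \sw_(a2, b1 <- Q1 (a1 ⊗ b)) a2 ⊗ (b1 ⊗ c1).

Lemma T1_map_linear : islinear T1_map. Proof. by rewrite /T1_map; lin. Qed.
Lemma V1_map_linear : islinear V1_map. Proof. by rewrite /V1_map; lin. Qed.
Lemma T2_map_linear : islinear T2_map. Proof. by rewrite /T2_map; lin. Qed.
Lemma V2_map_linear : islinear V2_map. Proof. by rewrite /V2_map; lin. Qed.

HB.instance Definition _ := GRing.isLinear.Build k _ _ *:%R T1_map T1_map_linear.
HB.instance Definition _ := GRing.isLinear.Build k _ _ *:%R V1_map V1_map_linear.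
HB.instance Definition _ := GRing.isLinear.Build k _ _ *:%R T2_map T2_map_linear.
HB.instance Definition _ := GRing.isLinear.Build k _ _ *:%R V2_map V2_map_linear.

Lemma T1_mapE a b c : T1_map (c ⊗ (a ⊗ b)) =
  \sw_(a1, c1 <- R3 (c ⊗ a)) \sw_(b1, c2 <- R2 (c1 ⊗ b)) (a1 ⊗ b1) ⊗ c2.
Proof. by rewrite /T1_map !sw_tens //; lin. Qed.

Lemma V1_mapE a b c : V1_map ((a ⊗ b) ⊗ c) =
  \sw_(a1, c1 <- Q3 (a ⊗ c)) \sw_(b1, c2 <- Q2 (b ⊗ c1)) (a1 ⊗ b1) ⊗ c2.
Proof. by rewrite /V1_map !sw_tens //; lin. Qed.

Lemma T2_mapE a b c : T2_map ((b ⊗ c) ⊗ a) =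
  \sw_(a1, c1 <- R3 (c ⊗ a)) \sw_(a2, b1 <- R1 (b ⊗ a1)) a2 ⊗ (b1 ⊗ c1).
Proof. by rewrite /T2_map !sw_tens //; lin. Qed.

Lemma V2_mapE a b c : V2_map (a ⊗ (b ⊗ c)) =
  \sw_(a1, c1 <- Q3 (a ⊗ c)) \sw_(a2, b1 <- Q1 (a1 ⊗ b)) a2 ⊗ (b1 ⊗ c1).
Proof. by rewrite /V2_map !sw_tens //; lin. Qed.

End IteratedMaps.

(* Main.v *)
(* Each condition for (A ⊗ B) ⊗ C unfolds to an equality of two Sweedler sums in which
   the same maps are applied in different orders; the order is changed by the conditions
   for the pairs (A, C) and (B, C) and by the eight compatibility conditions. The flip
   A ⊗ B -> B ⊗ A turns an L-R-twisted product with maps (R, Q) into one with maps (Q, R),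
   and turns the compatibility conditions for (A, B, C) into those for (C, B, A), so the
   case of A ⊗ (B ⊗ C) is the case of (C ⊗ B) ⊗ A transported along flips. The two
   products on A ⊗ B ⊗ C agree because R1 commutes with Q2 on B, and Q1 with R2. *)
Require Import Defs.
From HB Require Import structures.
From mathcomp Require Import all_boot all_algebra.

Import GRing.Theory.
Local Open Scope ring_scope.

Set Implicit Arguments.
Unset Strict Implicit.
Unset Printing Implicit Defensive.

(** * Linearity and rewriting of Sweedler sums *)

Definition istrilinear (k : fieldType) (U V W X : lmodType k) (F : U -> V -> W -> X) :=
  [/\ forall x y, islinear (fun z => F z x y),
      forall x y, islinear (fun z => F x z y) &
      forall x y, islinear (fun z => F x y z)].

Lemma lin_LR_mull (k : fieldType) (A B : ualgType k) (X : lmodType k)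
    (R : {linear tensor B A -> tensor A B}) (Q : {linear tensor A B -> tensor A B})
    (f : X -> A ⊗ B) (y : A ⊗ B) :
  islinear f -> islinear (fun x => LR_mul R Q (f x) y).
Proof. by move=> Hf c x z; rewrite Hf; apply: (LR_mul_bilinear R Q).1. Qed.

Lemma lin_LR_mulr (k : fieldType) (A B : ualgType k) (X : lmodType k)
    (R : {linear tensor B A -> tensor A B}) (Q : {linear tensor A B -> tensor A B})
    (f : X -> A ⊗ B) (y : A ⊗ B) :
  islinear f -> islinear (fun x => LR_mul R Q y (f x)).
Proof. by move=> Hf c x z; rewrite Hf; apply: (LR_mul_bilinear R Q).2. Qed.

(** Extends [lin_step] to [LR_mul] and to linearity hypotheses in the context, so that sums with an
    abstract multilinear summand are covered. *)
Ltac mlin_step :=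
  first [ lin_step
        | lazymatch goal with
          | |- GRing.linear_for _ (fun x => LR_mul _ _ (@?f x) (@?g x)) =>
              lazymatch g with
              | fun _ => ?t => apply: lin_LR_mull
              | _ => apply: lin_LR_mulr
              end
          | |- GRing.linear_for _ (LR_mul _ _ _) => apply: lin_LR_mulr
          end
        | match goal with H : forall _ _, GRing.linear_for _ _ |- _ => exact: H end ].
Ltac mlin :=
  lazymatch goal with
  | |- bilinear_for _ _ _ => split; intros ?
  | |- istrilinear _ => split; intros ? ?
  | |- forall _ _, _ => intros ? ?
  | |- _ => idtac
  end; repeat mlin_step.

(* Summations are numbered from 0, outermost first; [sw_rewrite n H] rewrites with
   [H] below the first [n] summations of the left-hand side, [sw_swap n] exchanges
   summations [n] and [n + 1], [sw_up i d] moves summation [i] up by [d] places. *)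
Ltac sw_under n tac :=
  lazymatch n with
  | O => tac
  | S ?m => refine (eq_sw _ _); intros ? ?; cbv beta; sw_under m tac
  end.
Ltac sw_rewrite n H :=
  etransitivity; [sw_under n ltac:(apply: H; solve [mlin]) | cbv beta].
Ltac sw_swap n :=
  etransitivity; [sw_under n ltac:(refine (sw_exchange _ _ _)) | cbv beta].
Ltac sw_rewrite_rev n H :=
  etransitivity;
  [sw_under n ltac:(simple refine (esym (H _ _ _ _ _ _)); solve [mlin]) | cbv beta].
Ltac sw_up i d :=
  lazymatch d with
  | O => idtac
  | S ?e => lazymatch i with S ?m => sw_swap m; sw_up m e end
  end.

Ltac sw_head t := lazymatch goal with |- sw _ ?s = _ => unify s t end.
(** Raising a summation fails when it depends on one above it; the next depth is tried as long as
    there is a summation at the current one. *)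
Ltac sw_pull t n :=
  first [ sw_up n n; sw_head t
        | assert_succeeds (etransitivity; [sw_under n ltac:(refine (eq_sw _ _))|]);
          sw_pull t (S n) ].
(* Equality up to reordering of independent summations: the outermost summation on
   the right is sought on the left and moved to the front. *)
Ltac sw_reorder :=
  lazymatch goal with
  | |- _ = sw _ ?t =>
      first [sw_head t | sw_pull t (S O)];
      refine (eq_sw _ _); intros ? ?; cbv beta; sw_reorder
  | |- _ => reflexivity
  end.

Ltac pure_tensor x :=
  move: x; lazymatch goal with
  |- forall x, @?f x = @?g x => refine (tensor_ext (f := f) (g := g) _ _ _);
     [solve [mlin]|solve [mlin]|cbv beta] end.

Ltac sw_out :=
  lazymatch goal with |- ?l = _ =>
  lazymatch l with context [sw ?f ?t] =>
  lazymatch eval pattern (sw f t) in l with ?g _ =>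
    refine (etrans (sw_compL (g := g) f t _) _); [solve [mlin]|cbv beta]
  end end end.

(* Moves all Sweedler sums to the front of the left-hand side, [rules] being
   tried on every subterm that is not yet expanded. *)
Ltac sw_expand rules :=
  lazymatch goal with
  | |- sw _ (sw _ _) = _ =>
      refine (etrans (sw_sw _ _ _) _); [solve [mlin]|cbv beta; sw_expand rules]
  | |- sw _ (tens _ _) = _ =>
      refine (etrans (sw_tens _ _ _) _); [solve [mlin]|cbv beta; sw_expand rules]
  | |- sw _ _ = _ =>
      tryif (etransitivity; [rules; reflexivity|cbv beta]) then sw_expand rules
      else (refine (eq_sw _ _); intros ? ?; cbv beta; sw_expand rules)
  | |- _ =>
      tryif (etransitivity; [rules; reflexivity|cbv beta]) then sw_expand rules
      else tryif sw_out then sw_expand rules else reflexivity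
  end.
Ltac sw_expand_both rules :=
  etransitivity; [sw_expand rules|symmetry; etransitivity; [sw_expand rules|symmetry]].

(** * The product of [A ⊗ B] with [C] *)

Section Compatible.
Context {k : fieldType} {A B C : ualgType k}.
Context (R1 : {linear tensor B A -> tensor A B}) (Q1 : {linear tensor A B -> tensor A B}).
Context (R2 : {linear tensor C B -> tensor B C}) (Q2 : {linear tensor B C -> tensor B C}).
Context (R3 : {linear tensor C A -> tensor A C}) (Q3 : {linear tensor A C -> tensor A C}).

(* A trilinear [F] in place of a triple tensor lets the identities be used inside a
   larger Sweedler sum. *)
Record compatible : Prop := Compatible {
  compat_RRR : forall (W : lmodType k) (F : A -> B -> C -> W) a b c, istrilinear F ->
    \sw_(a1, b1 <- R1 (b ⊗ a)) \sw_(a2, c1 <- R3 (c ⊗ a1))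
      \sw_(b2, c2 <- R2 (c1 ⊗ b1)) F a2 b2 c2 =
    \sw_(b1, c1 <- R2 (c ⊗ b)) \sw_(a1, c2 <- R3 (c1 ⊗ a))
      \sw_(a2, b2 <- R1 (b1 ⊗ a1)) F a2 b2 c2;
  compat_QQQ : forall (W : lmodType k) (F : A -> B -> C -> W) a b c, istrilinear F ->
    \sw_(a1, b1 <- Q1 (a ⊗ b)) \sw_(a2, c1 <- Q3 (a1 ⊗ c))
      \sw_(b2, c2 <- Q2 (b1 ⊗ c1)) F a2 b2 c2 =
    \sw_(b1, c1 <- Q2 (b ⊗ c)) \sw_(a1, c2 <- Q3 (a ⊗ c1))
      \sw_(a2, b2 <- Q1 (a1 ⊗ b1)) F a2 b2 c2;
  compat_R1Q2 : forall (W : lmodType k) (F : A -> B -> C -> W) a b c, istrilinear F ->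
    \sw_(a1, b1 <- R1 (b ⊗ a)) \sw_(b2, c1 <- Q2 (b1 ⊗ c)) F a1 b2 c1 =
    \sw_(b1, c1 <- Q2 (b ⊗ c)) \sw_(a1, b2 <- R1 (b1 ⊗ a)) F a1 b2 c1;
  compat_R2Q1 : forall (W : lmodType k) (F : A -> B -> C -> W) a b c, istrilinear F ->
    \sw_(b1, c1 <- R2 (c ⊗ b)) \sw_(a1, b2 <- Q1 (a ⊗ b1)) F a1 b2 c1 =
    \sw_(a1, b1 <- Q1 (a ⊗ b)) \sw_(b2, c1 <- R2 (c ⊗ b1)) F a1 b2 c1;
  compat_Q1R3 : forall (W : lmodType k) (F : A -> B -> C -> W) a b c, istrilinear F ->
    \sw_(a1, b1 <- Q1 (a ⊗ b)) \sw_(a2, c1 <- R3 (c ⊗ a1)) F a2 b1 c1 =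
    \sw_(a1, c1 <- R3 (c ⊗ a)) \sw_(a2, b1 <- Q1 (a1 ⊗ b)) F a2 b1 c1;
  compat_R1Q3 : forall (W : lmodType k) (F : A -> B -> C -> W) a b c, istrilinear F ->
    \sw_(a1, b1 <- R1 (b ⊗ a)) \sw_(a2, c1 <- Q3 (a1 ⊗ c)) F a2 b1 c1 =
    \sw_(a1, c1 <- Q3 (a ⊗ c)) \sw_(a2, b1 <- R1 (b ⊗ a1)) F a2 b1 c1;
  compat_Q2R3 : forall (W : lmodType k) (F : A -> B -> C -> W) a b c, istrilinear F ->
    \sw_(b1, c1 <- Q2 (b ⊗ c)) \sw_(a1, c2 <- R3 (c1 ⊗ a)) F a1 b1 c2 =
    \sw_(a1, c1 <- R3 (c ⊗ a)) \sw_(b1, c2 <- Q2 (b ⊗ c1)) F a1 b1 c2;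
  compat_Q3R2 : forall (W : lmodType k) (F : A -> B -> C -> W) a b c, istrilinear F ->
    \sw_(a1, c1 <- Q3 (a ⊗ c)) \sw_(b1, c2 <- R2 (c1 ⊗ b)) F a1 b1 c2 =
    \sw_(b1, c1 <- R2 (c ⊗ b)) \sw_(a1, c2 <- Q3 (a ⊗ c1)) F a1 b1 c2
}.

Local Notation T1 := (T1_map R2 R3 : {linear (C ⊗ (A ⊗ B))%type -> ((A ⊗ B) ⊗ C)%type}).
Local Notation V1 := (V1_map Q2 Q3 : {linear ((A ⊗ B) ⊗ C)%type -> ((A ⊗ B) ⊗ C)%type}).
Local Notation mul := (LR_mul R1 Q1).

Lemma T1E a b c : T1 (c ⊗ (a ⊗ b)) =
  \sw_(a1, c1 <- R3 (c ⊗ a)) \sw_(b1, c2 <- R2 (c1 ⊗ b)) (a1 ⊗ b1) ⊗ c2.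
Proof. exact: T1_mapE. Qed.

Lemma V1E a b c : V1 ((a ⊗ b) ⊗ c) =
  \sw_(a1, c1 <- Q3 (a ⊗ c)) \sw_(b1, c2 <- Q2 (b ⊗ c1)) (a1 ⊗ b1) ⊗ c2.
Proof. exact: V1_mapE. Qed.

Hypotheses (AB : LR_twisted R1 Q1) (BC : LR_twisted R2 Q2) (AC : LR_twisted R3 Q3).
Hypothesis compat : compatible.

Local Ltac rules :=
  first [ rewrite T1E | rewrite V1E | rewrite LR_mulE
        | rewrite (LR_R1l AC) | rewrite (LR_R1l BC) | rewrite (LR_R1r AC) | rewrite (LR_R1r BC)
        | rewrite (LR_Q1l AC) | rewrite (LR_Q1l BC) | rewrite (LR_Q1r AC) | rewrite (LR_Q1r BC)
        | rewrite (LR_RMl AC) | rewrite (LR_RMl BC) | rewrite (LR_RMr AC) | rewrite (LR_RMr BC)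
        | rewrite (LR_QMl AC) | rewrite (LR_QMl BC) | rewrite (LR_QMr AC) | rewrite (LR_QMr BC) ].

Lemma T1_1l x : T1 (\1 ⊗ x) = x ⊗ \1.
Proof. by pure_tensor x => a b; sw_expand rules. Qed.

Lemma T1_1r c : T1 (c ⊗ (\1 ⊗ \1)) = (\1 ⊗ \1) ⊗ c.
Proof. by sw_expand rules. Qed.

Lemma V1_1l c : V1 ((\1 ⊗ \1) ⊗ c) = (\1 ⊗ \1) ⊗ c.
Proof. by sw_expand rules. Qed.

Lemma V1_1r x : V1 (x ⊗ \1) = x ⊗ \1.
Proof. by pure_tensor x => a b; sw_expand rules. Qed.

(** After expansion the right-hand side applies [R3], [R2], [R3], [R2], [Q1], [R1] in this order,
    while the left-hand side starts with the product, that is with [Q1] and [R1]. Two commutation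
    conditions move [Q1] up past an [R2] and an [R3]; the braid-type relation [compat_RRR] brings
    [R1] before the other [R2] and [R3]. *)
Lemma T1_mull c x x' :
  T1 (c ⊗ mul x x') =
  \sw_(x1, c1 <- T1 (c ⊗ x)) \sw_(x2, c2 <- T1 (c1 ⊗ x')) mul x1 x2 ⊗ c2.
Proof.
pure_tensor x => a b; pure_tensor x' => a' b'; sw_expand_both rules; symmetry.
sw_rewrite 3%N (compat_R2Q1 compat).
sw_up 3%N 2%N; sw_rewrite_rev 0%N (compat_Q1R3 compat).
sw_up 5%N 1%N; sw_rewrite_rev 2%N (compat_RRR compat).
by sw_reorder.
Qed.

(** Mirrors [T1_mull] with [Q1] and [R1] exchanged: [R1] commutes past [Q2] and [Q3], and
    [compat_QQQ] moves [Q1]. *)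
Lemma V1_mull c x x' :
  V1 (mul x x' ⊗ c) =
  \sw_(x1, c1 <- V1 (x' ⊗ c)) \sw_(x2, c2 <- V1 (x ⊗ c1)) mul x2 x1 ⊗ c2.
Proof.
pure_tensor x => a b; pure_tensor x' => a' b'; sw_expand_both rules; symmetry.
sw_up 5%N 1%N; sw_rewrite_rev 3%N (compat_R1Q2 compat).
sw_up 3%N 2%N; sw_rewrite_rev 0%N (compat_R1Q3 compat).
sw_up 5%N 1%N; sw_rewrite_rev 2%N (compat_QQQ compat).
by sw_reorder.
Qed.

Lemma T1_mulr c c' x :
  T1 ((c · c') ⊗ x) =
  \sw_(x1, c1 <- T1 (c' ⊗ x)) \sw_(x2, c2 <- T1 (c ⊗ x1)) x2 ⊗ (c2 · c1).
Proof. by pure_tensor x => a b; sw_expand_both rules; sw_reorder. Qed.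

Lemma V1_mulr c c' x :
  V1 (x ⊗ (c · c')) =
  \sw_(x1, c1 <- V1 (x ⊗ c)) \sw_(x2, c2 <- V1 (x1 ⊗ c')) x2 ⊗ (c1 · c2).
Proof. by pure_tensor x => a b; sw_expand_both rules; sw_reorder. Qed.

(** [R3] and [Q3] commute on [a], and [R2] and [Q2] commute on [b], by [LR_RQl] for the two
    pairs. *)
Lemma T1_V1l c c' x :
  \sw_(x1, c1 <- T1 (c ⊗ x)) \sw_(x2, c2 <- V1 (x1 ⊗ c')) c1 ⊗ (x2 ⊗ c2) =
  \sw_(x1, c1 <- V1 (x ⊗ c')) \sw_(x2, c2 <- T1 (c ⊗ x1)) c2 ⊗ (x2 ⊗ c1).
Proof.
pure_tensor x => a b; sw_expand_both rules.
sw_up 2%N 1%N; sw_rewrite 0%N (LR_RQl_sw AC); sw_rewrite 2%N (LR_RQl_sw BC).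
by sw_reorder.
Qed.

(** All four maps act on the same element of [C]. Turning the order [R3], [R2], [Q3], [Q2] into
    [Q3], [Q2], [R3], [R2] takes four exchanges of neighbours: two by [LR_RQr] for the pairs (A, C)
    and (B, C), and the two mixed ones by compatibility. *)
Lemma T1_V1r c x x' :
  \sw_(x1, c1 <- T1 (c ⊗ x)) \sw_(x2, c2 <- V1 (x' ⊗ c1)) x1 ⊗ (c2 ⊗ x2) =
  \sw_(x1, c1 <- V1 (x' ⊗ c)) \sw_(x2, c2 <- T1 (c1 ⊗ x)) x2 ⊗ (c2 ⊗ x1).
Proof.
pure_tensor x => a b; pure_tensor x' => a' b'; sw_expand_both rules.
sw_rewrite_rev 1%N (compat_Q3R2 compat).
sw_rewrite 0%N (LR_RQr_sw AC); sw_rewrite 2%N (LR_RQr_sw BC).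
sw_rewrite_rev 1%N (compat_Q2R3 compat).
by sw_reorder.
Qed.

(** The product of [LR_tensor AB] is [LR_mul R1 Q1] by conversion, so the ten identities above apply
    as they stand. *)
Lemma LR_twisted_T1_V1 :
  @LR_twisted k (LR_tensor AB) C (T1_map R2 R3) (V1_map Q2 Q3).
Proof.
split.
- exact: T1_1l.
- exact: T1_1r.
- by move=> x x' c; apply: T1_mull.
- by move=> x c c'; apply: T1_mulr.
- exact: V1_1r.
- exact: V1_1l.
- by move=> x x' c; apply: V1_mull.
- by move=> x c c'; apply: V1_mulr.
- by move=> x c c'; apply: T1_V1l.
- by move=> x x' c; apply: T1_V1r.
Qed.

End Compatible.

(** * Flipping the tensor factors *)

Section Flip.
Context {k : fieldType}.
Implicit Types U V : lmodType k.

Definition tensor_flip U V (t : U ⊗ V) : V ⊗ U := \sw_(u, v <- t) v ⊗ u.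

Lemma tensor_flip_linear U V : islinear (@tensor_flip U V).
Proof. by rewrite /tensor_flip; lin. Qed.

HB.instance Definition _ U V :=
  GRing.isLinear.Build k (U ⊗ V)%type (V ⊗ U)%type *:%R (@tensor_flip U V)
    (@tensor_flip_linear U V).

Lemma tensor_flipE U V (u : U) (v : V) : tensor_flip (u ⊗ v) = v ⊗ u.
Proof. by rewrite /tensor_flip sw_tens //; lin. Qed.

Lemma tensor_flipK U V : cancel (@tensor_flip U V) (@tensor_flip V U).
Proof.
apply: (tensor_ext (f := fun t : U ⊗ V => tensor_flip (tensor_flip t)) (g := fun t => t)).
- by move=> c x y; rewrite !tensor_flip_linear.
- by lin.
- by move=> u v; rewrite !tensor_flipE.
Qed.

End Flip.

(** Only the output is flipped: [flip_out Q] and [flip_out R] then have the types of the R-map and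
    the Q-map of a product on [B ⊗ A]. *)
Definition flip_out (k : fieldType) (U V X : lmodType k)
    (f : {linear X -> tensor U V}) : {linear X -> tensor V U} :=
  (@tensor_flip k U V) \o f.

Lemma flip_outE (k : fieldType) (U V X : lmodType k)
    (f : {linear X -> tensor U V}) x :
  flip_out f x = \sw_(u, v <- f x) v ⊗ u.
Proof. by []. Qed.

(* Flipping the factors exchanges the roles of [R] and [Q], without passing to
   opposite algebras: [b_R b'_Q ⊗ a_Q a'_R] is the product of [b ⊗ a] and [b' ⊗ a'] for
   the maps obtained from [Q] (as the new R) and [R] (as the new Q). *)
Section FlipTransport.
Context {k : fieldType} {A A' B : ualgType k}.
Context (R : {linear tensor B A -> tensor A B}) (Q : {linear tensor A B -> tensor A B}).
Context (R' : {linear tensor A' B -> tensor B A'}) (Q' : {linear tensor B A' -> tensor B A'}).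
Context (f : {linear A -> A'}) (g : A' -> A).
Hypotheses (gK : cancel g f) (f1 : f \1 = \1).
Hypothesis fM : forall x y, f (x · y) = f x · f y.
Hypothesis R'E : forall a b, R' (f a ⊗ b) = \sw_(a1, b1 <- Q (a ⊗ b)) b1 ⊗ f a1.
Hypothesis Q'E : forall a b, Q' (b ⊗ f a) = \sw_(a1, b1 <- R (b ⊗ a)) b1 ⊗ f a1.

(** The isomorphism [f] is the identity for a plain flip; with [f] the flip from [C ⊗ B] to [B ⊗ C]
    the lemma also reverses the inner product of an iterated one. *)
Lemma LR_twisted_flip_iso : LR_twisted R Q -> LR_twisted R' Q'.
Proof.
move=> RQ.
have fS a' : exists a, a' = f a by exists (g a').
split.
- by move=> b; rewrite -f1 R'E (LR_Q1l RQ) sw_tens //; mlin.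
- by move=> a'; have [a ->] := fS a'; rewrite R'E (LR_Q1r RQ) sw_tens //; mlin.
- move=> b b' a'; have [a ->] := fS a'.
  by sw_expand_both ltac:(first [ rewrite R'E | rewrite (LR_QMr RQ) ]); sw_reorder.
- move=> b a' a2'; have [a ->] := fS a'; have [a2 ->] := fS a2'.
  by sw_expand_both ltac:(first [ rewrite -fM | rewrite R'E | rewrite (LR_QMl RQ) ]); sw_reorder.
- by move=> a'; rewrite -f1 Q'E (LR_R1r RQ) sw_tens //; mlin.
- by move=> a'; have [a ->] := fS a'; rewrite Q'E (LR_R1l RQ) sw_tens //; mlin.
- move=> b b' a'; have [a ->] := fS a'.
  by sw_expand_both ltac:(first [ rewrite Q'E | rewrite (LR_RMr RQ) ]); sw_reorder.
- move=> b a' a2'; have [a ->] := fS a'; have [a2 ->] := fS a2'.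
  by sw_expand_both ltac:(first [ rewrite -fM | rewrite Q'E | rewrite (LR_RMl RQ) ]); sw_reorder.
- move=> b a' a2'; have [a ->] := fS a'; have [a2 ->] := fS a2'.
  sw_expand_both ltac:(first [ rewrite R'E | rewrite Q'E ]).
  by symmetry; sw_rewrite 0%N (LR_RQr_sw RQ).
- move=> b b' a'; have [a ->] := fS a'.
  sw_expand_both ltac:(first [ rewrite R'E | rewrite Q'E ]).
  by symmetry; sw_rewrite 0%N (LR_RQl_sw RQ).
Qed.

End FlipTransport.

Lemma LR_twisted_flip (k : fieldType) (A B : ualgType k)
    (R : {linear tensor B A -> tensor A B}) (Q : {linear tensor A B -> tensor A B}) :
  LR_twisted R Q -> LR_twisted (flip_out Q) (flip_out R).
Proof. by apply: (@LR_twisted_flip_iso k A A B R Q _ _ idfun id). Qed.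

(** Reversing the triple permutes the conditions: [compat_RRR] and [compat_QQQ] are exchanged, as
    are [compat_Q1R3] and [compat_Q3R2], and [compat_R1Q3] and [compat_Q2R3]; the other two are
    preserved. *)
Lemma compatible_flip (k : fieldType) (A B C : ualgType k)
    (R1 : {linear tensor B A -> tensor A B}) (Q1 : {linear tensor A B -> tensor A B})
    (R2 : {linear tensor C B -> tensor B C}) (Q2 : {linear tensor B C -> tensor B C})
    (R3 : {linear tensor C A -> tensor A C}) (Q3 : {linear tensor A C -> tensor A C}) :
  compatible R1 Q1 R2 Q2 R3 Q3 ->
  compatible (flip_out Q2) (flip_out R2) (flip_out Q1) (flip_out R1)
    (flip_out Q3) (flip_out R3).
Proof.
move=> cQ; split=> W F c b a [F1 F2 F3]; sw_expand_both ltac:(rewrite flip_outE).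
- by sw_rewrite_rev 0%N (compat_QQQ cQ).
- by sw_rewrite_rev 0%N (compat_RRR cQ).
- by sw_rewrite_rev 0%N (compat_R1Q2 cQ).
- by sw_rewrite_rev 0%N (compat_R2Q1 cQ).
- by sw_rewrite_rev 0%N (compat_Q3R2 cQ).
- by sw_rewrite 0%N (compat_Q2R3 cQ).
- by sw_rewrite 0%N (compat_R1Q3 cQ).
- by sw_rewrite_rev 0%N (compat_Q1R3 cQ).
Qed.

(** * The product of [A] with [B ⊗ C] and its comparison with the first one *)

Lemma tensor3_bilinear_ext (k : fieldType) (U V W X : lmodType k)
    (F G : (U ⊗ V) ⊗ W -> (U ⊗ V) ⊗ W -> X) :
  isbilinear F -> isbilinear G ->
  (forall u v w u' v' w',
    F ((u ⊗ v) ⊗ w) ((u' ⊗ v') ⊗ w') = G ((u ⊗ v) ⊗ w) ((u' ⊗ v') ⊗ w')) ->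
  F =2 G.
Proof.
move=> [Fl Fr] [Gl Gr] FG x y.
have comp (g : (U ⊗ V) ⊗ W -> X) w : islinear g -> islinear (fun t => g (t ⊗ w)).
  by move=> gL c t t'; rewrite tens_bilinear.1 gL.
move: x; refine (tensor_ext (Fl y) (Gl y) _) => s w.
move: s; refine (tensor_ext (comp _ w (Fl y)) (comp _ w (Gl y)) _) => u v.
move: y; refine (tensor_ext (Fr _) (Gr _) _) => s' w'.
move: s'; refine (tensor_ext (comp _ w' (Fr _)) (comp _ w' (Gr _)) _) => u' v'.
exact: FG.
Qed.

Section Iterated.
Context {k : fieldType} {A B C : ualgType k}.
Context (R1 : {linear tensor B A -> tensor A B}) (Q1 : {linear tensor A B -> tensor A B}).
Context (R2 : {linear tensor C B -> tensor B C}) (Q2 : {linear tensor B C -> tensor B C}).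
Context (R3 : {linear tensor C A -> tensor A C}) (Q3 : {linear tensor A C -> tensor A C}).
Hypotheses (AB : LR_twisted R1 Q1) (BC : LR_twisted R2 Q2) (AC : LR_twisted R3 Q3).
Hypothesis compat : compatible R1 Q1 R2 Q2 R3 Q3.

Local Notation T1 := (T1_map R2 R3 : {linear (C ⊗ (A ⊗ B))%type -> ((A ⊗ B) ⊗ C)%type}).
Local Notation V1 := (V1_map Q2 Q3 : {linear ((A ⊗ B) ⊗ C)%type -> ((A ⊗ B) ⊗ C)%type}).
Local Notation T2 := (T2_map R1 R3 : {linear ((B ⊗ C) ⊗ A)%type -> (A ⊗ (B ⊗ C))%type}).
Local Notation V2 := (V2_map Q1 Q3 : {linear (A ⊗ (B ⊗ C))%type -> (A ⊗ (B ⊗ C))%type}).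
Local Notation T1' := (T1_map (flip_out Q1) (flip_out Q3) :
  {linear (A ⊗ (C ⊗ B))%type -> ((C ⊗ B) ⊗ A)%type}).
Local Notation V1' := (V1_map (flip_out R1) (flip_out R3) :
  {linear ((C ⊗ B) ⊗ A)%type -> ((C ⊗ B) ⊗ A)%type}).
Local Notation flip := (@tensor_flip k C B : {linear (C ⊗ B)%type -> (B ⊗ C)%type}).

Lemma T2E a b c : T2 ((b ⊗ c) ⊗ a) =
  \sw_(a1, c1 <- R3 (c ⊗ a)) \sw_(a2, b1 <- R1 (b ⊗ a1)) a2 ⊗ (b1 ⊗ c1).
Proof. exact: T2_mapE. Qed.

Lemma V2E a b c : V2 (a ⊗ (b ⊗ c)) =
  \sw_(a1, c1 <- Q3 (a ⊗ c)) \sw_(a2, b1 <- Q1 (a1 ⊗ b)) a2 ⊗ (b1 ⊗ c1).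
Proof. exact: V2_mapE. Qed.

Lemma flipE b c : flip (c ⊗ b) = b ⊗ c.
Proof. exact: tensor_flipE. Qed.

Lemma flip_mul x y :
  flip (LR_mul (flip_out Q2) (flip_out R2) x y) = LR_mul R2 Q2 (flip x) (flip y).
Proof.
pure_tensor x => c b; pure_tensor y => c' b'.
sw_expand_both ltac:(first [ rewrite LR_mulE | rewrite flip_outE | rewrite flipE ]).
by sw_reorder.
Qed.

(** Up to flips, [T2] is the V-map of the reversed triple, and [V2] its T-map; these are the
    hypotheses [R'E] and [Q'E] of [LR_twisted_flip_iso]. *)
Lemma T2_flip x a : T2 (flip x ⊗ a) = \sw_(x1, a1 <- V1' (x ⊗ a)) a1 ⊗ flip x1.
Proof.
pure_tensor x => c b.
by sw_expand_both ltac:(first [ rewrite T2E | rewrite V1E | rewrite flip_outE | rewrite flipE ]).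
Qed.

Lemma V2_flip x a : V2 (a ⊗ flip x) = \sw_(x1, a1 <- T1' (a ⊗ x)) a1 ⊗ flip x1.
Proof.
pure_tensor x => c b.
by sw_expand_both ltac:(first [ rewrite V2E | rewrite T1E | rewrite flip_outE | rewrite flipE ]).
Qed.

Lemma LR_twisted_T2_V2 :
  @LR_twisted k A (LR_tensor BC) (T2_map R1 R3) (V2_map Q1 Q3).
Proof.
have CB := LR_twisted_flip BC.
(* The first half of the theorem for the triple (C, B, A). *)
have twC := LR_twisted_T1_V1 CB (LR_twisted_flip AB) (LR_twisted_flip AC)
  (compatible_flip compat).
apply: (@LR_twisted_flip_iso k (LR_tensor CB) (LR_tensor BC) A _ _ _ _
  flip (@tensor_flip k B C) _ _ _ _ _ twC).
- exact: tensor_flipK.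
- exact: tensor_flipE.
- exact: flip_mul.
- by move=> x a; apply: T2_flip.
- by move=> a x; apply: V2_flip.
Qed.

Local Notation asc := (tensor_assoc : {linear ((A ⊗ B) ⊗ C)%type -> (A ⊗ (B ⊗ C))%type}).

Lemma tensor_assoc_LR_mul (x y : (A ⊗ B) ⊗ C) :
  asc (@LR_mul k (LR_tensor AB) C T1 V1 x y) =
  @LR_mul k A (LR_tensor BC) T2 V2 (asc x) (asc y).
Proof.
(* [E1] and [E2] show the inner product as [LR_mul] rather than as the product of [LR_tensor], so
   that it can be expanded in turn. *)
have E1 u c u' c' : @LR_mul k (LR_tensor AB) C T1 V1 (u ⊗ c) (u' ⊗ c') =
  \sw_(u1, c1' <- V1 (u ⊗ c')) \sw_(u1', c1 <- T1 (c ⊗ u'))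
    LR_mul R1 Q1 u1 u1' ⊗ (c1 · c1') by exact: LR_mulE.
have E2 a v a' v' : @LR_mul k A (LR_tensor BC) T2 V2 (a ⊗ v) (a' ⊗ v') =
  \sw_(a1, v1' <- V2 (a ⊗ v')) \sw_(a1', v1 <- T2 (v ⊗ a'))
    (a1 · a1') ⊗ LR_mul R2 Q2 v1 v1' by exact: LR_mulE.
have E3 a b c : asc ((a ⊗ b) ⊗ c) = a ⊗ (b ⊗ c) by exact: tensor_assocE.
move: x y; apply: tensor3_bilinear_ext.
- have [Ml Mr] := @LR_mul_bilinear k (LR_tensor AB) C T1 V1.
  by split=> [y|x] c u v; rewrite ?Ml ?Mr linearP.
- have [Ml Mr] := @LR_mul_bilinear k A (LR_tensor BC) T2 V2.
  by split=> [y|x] c u v; rewrite linearP ?Ml ?Mr.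
move=> a b c a' b' c'.
sw_expand_both ltac:(first [ rewrite E3 | rewrite E1 | rewrite E2 | rewrite LR_mulE
  | rewrite T1E | rewrite V1E | rewrite T2E | rewrite V2E ]).
(* The left-hand side applies [R2] before [Q1] and [Q2] before [R1]; the right-hand side has both in
   the opposite order. *)
sw_rewrite 3%N (compat_R2Q1 compat); sw_up 2%N 1%N; sw_up 5%N 2%N.
sw_rewrite_rev 2%N (compat_R1Q2 compat).
by sw_reorder.
Qed.

End Iterated.

(** Applies to both sides of [e] the linear map on the triple tensor product that the trilinear [F]
    induces, which gives the form required by [compatible]. *)
Ltac sw_lift e :=
  case=> + + +; move=> /trilinear_lift /[apply] /[apply] [[? ? ?]];
  lazymatch goal with GL : GRing.linear_for _ ?G, GE : forall x y z, ?G _ = _ |- _ =>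
    let push := (do ?[refine (etrans (sw_compL _ _ GL) _); apply: eq_sw => ? ?];
                 exact: GE) in
    etransitivity; [symmetry; push|etransitivity; [exact: (congr1 G e)|push]]
  end.

Theorem theorem3p3 (k : fieldType) (A B C : ualgType k)
    (R1 : {linear tensor B A -> tensor A B}) (Q1 : {linear tensor A B -> tensor A B})
    (R2 : {linear tensor C B -> tensor B C}) (Q2 : {linear tensor B C -> tensor B C})
    (R3 : {linear tensor C A -> tensor A C}) (Q3 : {linear tensor A C -> tensor A C})
    (AB : LR_twisted R1 Q1) (BC : LR_twisted R2 Q2) (AC : LR_twisted R3 Q3)
    (H1 : forall (a : A) (b : B) (c : C),
      \sw_(a1, b1 <- R1 (b ⊗ a)) \sw_(a2, c1 <- R3 (c ⊗ a1))
        \sw_(b2, c2 <- R2 (c1 ⊗ b1)) a2 ⊗ (b2 ⊗ c2) =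
      \sw_(b1, c1 <- R2 (c ⊗ b)) \sw_(a1, c2 <- R3 (c1 ⊗ a))
        \sw_(a2, b2 <- R1 (b1 ⊗ a1)) a2 ⊗ (b2 ⊗ c2))
    (H2 : forall (a : A) (b : B) (c : C),
      \sw_(a1, b1 <- Q1 (a ⊗ b)) \sw_(a2, c1 <- Q3 (a1 ⊗ c))
        \sw_(b2, c2 <- Q2 (b1 ⊗ c1)) a2 ⊗ (b2 ⊗ c2) =
      \sw_(b1, c1 <- Q2 (b ⊗ c)) \sw_(a1, c2 <- Q3 (a ⊗ c1))
        \sw_(a2, b2 <- Q1 (a1 ⊗ b1)) a2 ⊗ (b2 ⊗ c2))
    (H3 : forall (a : A) (b : B) (c : C),
      \sw_(a1, b1 <- R1 (b ⊗ a)) \sw_(b2, c1 <- Q2 (b1 ⊗ c)) a1 ⊗ (b2 ⊗ c1) =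
      \sw_(b1, c1 <- Q2 (b ⊗ c)) \sw_(a1, b2 <- R1 (b1 ⊗ a)) a1 ⊗ (b2 ⊗ c1))
    (H4 : forall (a : A) (b : B) (c : C),
      \sw_(b1, c1 <- R2 (c ⊗ b)) \sw_(a1, b2 <- Q1 (a ⊗ b1)) a1 ⊗ (b2 ⊗ c1) =
      \sw_(a1, b1 <- Q1 (a ⊗ b)) \sw_(b2, c1 <- R2 (c ⊗ b1)) a1 ⊗ (b2 ⊗ c1))
    (H5 : forall (a : A) (b : B) (c : C),
      \sw_(a1, b1 <- Q1 (a ⊗ b)) \sw_(a2, c1 <- R3 (c ⊗ a1)) a2 ⊗ (b1 ⊗ c1) =
      \sw_(a1, c1 <- R3 (c ⊗ a)) \sw_(a2, b1 <- Q1 (a1 ⊗ b)) a2 ⊗ (b1 ⊗ c1))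
    (H6 : forall (a : A) (b : B) (c : C),
      \sw_(a1, b1 <- R1 (b ⊗ a)) \sw_(a2, c1 <- Q3 (a1 ⊗ c)) a2 ⊗ (b1 ⊗ c1) =
      \sw_(a1, c1 <- Q3 (a ⊗ c)) \sw_(a2, b1 <- R1 (b ⊗ a1)) a2 ⊗ (b1 ⊗ c1))
    (H7 : forall (a : A) (b : B) (c : C),
      \sw_(b1, c1 <- Q2 (b ⊗ c)) \sw_(a1, c2 <- R3 (c1 ⊗ a)) a1 ⊗ (b1 ⊗ c2) =
      \sw_(a1, c1 <- R3 (c ⊗ a)) \sw_(b1, c2 <- Q2 (b ⊗ c1)) a1 ⊗ (b1 ⊗ c2))
    (H8 : forall (a : A) (b : B) (c : C),
      \sw_(a1, c1 <- Q3 (a ⊗ c)) \sw_(b1, c2 <- R2 (c1 ⊗ b)) a1 ⊗ (b1 ⊗ c2) =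
      \sw_(b1, c1 <- R2 (c ⊗ b)) \sw_(a1, c2 <- Q3 (a ⊗ c1)) a1 ⊗ (b1 ⊗ c2)) :
  exists (ABC : @LR_twisted k (LR_tensor AB) C (T1_map R2 R3) (V1_map Q2 Q3))
         (ABC' : @LR_twisted k A (LR_tensor BC) (T2_map R1 R3) (V2_map Q1 Q3)),
    unital_algebra_iso
      (tensor_assoc : LR_tensor ABC -> LR_tensor ABC').
Proof.
have compat : compatible R1 Q1 R2 Q2 R3 Q3.
  split=> W F a b c.
  - sw_lift (H1 a b c).
  - sw_lift (H2 a b c).
  - sw_lift (H3 a b c).
  - sw_lift (H4 a b c).
  - sw_lift (H5 a b c).
  - sw_lift (H6 a b c).
  - sw_lift (H7 a b c).
  - sw_lift (H8 a b c).
exists (LR_twisted_T1_V1 AB BC AC compat), (LR_twisted_T2_V2 AB BC AC compat).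
split.
- exact: tensor_assoc_linear.
- exact: tensor_assoc_bij.
- exact: tensor_assocE.
- exact: tensor_assoc_LR_mul.
Qed.
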